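(* Let $S$ be a positive integer and let $N_S \geq 0$ be an integer. Suppose that $m_A \geq S/3$ for every set $A \subset \mathbb{Z}_{>0}$ of size $n$ and every integer $n$ with $N_S < n \leq 3N_S + 2S$. Then $m_A \geq S/3$ for every finite set $A \subset \mathbb{Z}_{>0}$ of size $n$ and every integer $n > N_S$.
   Context: Let $f:\mathbb{R}\to\mathbb{R}$ be the $1$-periodic function with $f(x) = 1_{[1/3,2/3)}(x) - 1/3$ for $x \in [0,1)$. For a finite set $A \subset \mathbb{Z}_{>0}$ put $f_A(x) = \sum_{a \in A} f(ax)$ and $m_A = \max_{x \in \mathbb{R}} f_A(x)$. *)

(* Defs.v *)
From HB Require Import structures.
From mathcomp Require Import all_boot all_order all_algebra finmap.
From mathcomp Require Import all_classical all_reals all_analysis.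
From mathcomp Require Import ring lra.

Set Implicit Arguments.
Unset Strict Implicit.
Unset Printing Implicit Defensive.

Import Order.TTheory GRing.Theory Num.Theory.

Local Open Scope classical_set_scope.
Local Open Scope ring_scope.

Definition fracpart (R : realType) (x : R) : R := x - (Num.floor x)%:~R.

Definition f (R : realType) (x : R) : R :=
  \1_(`[1 / 3, 2 / 3[%classic : set R) (fracpart x) - 1 / 3.

Definition f_sum (R : realType) (A : {fset nat}) (x : R) : R :=
  \sum_(a <- A) f (a%:R * x).

(* The supremum below is a maximum: see [m_max_attained] and [m_max_ub]. *)
Definition m_max (R : realType) (A : {fset nat}) : R :=
  sup (range (@f_sum R A)).

Lemma f_periodic (R : realType) (x : R) : f (x + 1) = f x.
Proof.
rewrite /f /fracpart floorDrz ?rpred1 // floor1 intrD; congr (\1_ _ _ - _); ring.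
Qed.

Lemma f_unit (R : realType) (x : R) : 0 <= x < 1 ->
  f x = \1_(`[1 / 3, 2 / 3[%classic : set R) x - 1 / 3.
Proof.
move=> hx; rewrite /f /fracpart (_ : Num.floor x = 0) ?subr0 //.
by apply/floor_def; rewrite add0r.
Qed.

Lemma f_sum_count (R : realType) (A : {fset nat}) (x : R) :
  exists2 k : nat, (k <= #|` A|)%N & f_sum A x = k%:R - #|` A|%:R / 3.
Proof.
pose p (a : nat) := fracpart (a%:R * x) \in (`[1 / 3, 2 / 3[%classic : set R).
exists (count p A); first exact: count_size.
rewrite /f_sum; elim: (enum_fset A) => [|a s IH] /=.
  by rewrite big_nil mul0r subr0.
rewrite big_cons IH /f indicE -/(p a) natrD -[(size s).+1]add1n natrD; ring.
Qed.

Lemma m_maxP (R : realType) (A : {fset nat}) :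
  exists2 x : R, f_sum A x = m_max R A & forall y : R, f_sum A y <= m_max R A.
Proof.
pose P (k : nat) := `[< exists x : R, f_sum A x = k%:R - #|` A|%:R / 3 >].
have exP : exists k, P k.
  by have [k _ hk] := f_sum_count A (0 : R); exists k; apply/asboolP; exists 0.
have ubP k : P k -> (k <= #|` A|)%N.
  move=> /asboolP[x hx]; have [j hj hx'] := f_sum_count A x.
  by move: hx; rewrite hx' => /addIr /eqP; rewrite eqr_nat => /eqP <-.
case: (ex_maxnP exP ubP) => k /asboolP[x hx] kmax.
have ub y : f_sum A y <= f_sum A x.
  have [j _ hj] := f_sum_count A y.
  by rewrite hj hx lerD2r ler_nat; apply: kmax; apply/asboolP; exists y.
have mE : m_max R A = f_sum A x.
  apply/eqP; rewrite eq_le; apply/andP; split.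
    by apply: ge_sup => [|_ [y _ <-]]; [exists (f_sum A x), x|].
  by apply: ub_le_sup; [exists (f_sum A x) => _ [y _ <-]|exists x].
by exists x; rewrite mE.
Qed.

Lemma m_max_attained (R : realType) (A : {fset nat}) :
  exists x : R, f_sum A x = m_max R A.
Proof. by have [x hx _] := m_maxP R A; exists x. Qed.

Lemma m_max_ub (R : realType) (A : {fset nat}) (x : R) :
  f_sum A x <= m_max R A.
Proof. by have [_ _] := m_maxP R A; apply. Qed.

(* Main.v *)
Require Import Defs.
From mathcomp Require Import all_boot all_order all_algebra finmap.
From mathcomp Require Import all_classical all_reals all_analysis.
From mathcomp Require Import zify ring lra.

Import Order.TTheory GRing.Theory Num.Theory.

Local Open Scope ring_scope.

(** The three translates [f y], [f (y + 1/3)], [f (y + 2/3)] sum to zero, so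
    averaging [f_A] over [x], [x + 1/3], [x + 2/3] keeps only the multiples of 3
    in [A]; dividing these by 3 gives a set [B] of smaller integers with
    [m_B <= m_A].  If [B] has more than [N_S] elements, descend to [B].
    Otherwise most elements of [A] are not divisible by 3; evaluating [f_A] at
    [1/3] counts those congruent to 1 mod 3, and just below [1/3] those
    congruent to 2 mod 3, and the larger of the two values is at least [S/3]
    once [A] has more than [3 N_S + 2 S] elements. *)

Lemma fDint (R : realType) (y : R) (k : int) : f (y + k%:~R) = f y.
Proof.
rewrite /f /fracpart floorDrz ?intr_int // intrKfloor intrD.
by congr (\1_ _ _ - _); ring.
Qed.

Lemma fDnat (R : realType) (y : R) (k : nat) : f (y + k%:R) = f y.
Proof. by rewrite pmulrn fDint. Qed.

Lemma fracpart_itv (R : realType) (y : R) : 0 <= fracpart y < 1.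
Proof. by rewrite /fracpart subr_ge0 floor_le ltrBlDl -intrD1 floorD1_gt. Qed.

Lemma f_middle_third (R : realType) (t : R) : 1 / 3 <= t < 2 / 3 -> f t = 2 / 3.
Proof.
move=> ht; rewrite f_unit; last by lra.
rewrite indicE mem_set /=; first by lra.
by rewrite in_itv.
Qed.

Lemma f_outer_thirds (R : realType) (t : R) :
  0 <= t < 1 -> (t < 1 / 3) || (2 / 3 <= t) -> f t = - (1 / 3).
Proof.
move=> ht1 ht; rewrite f_unit // indicE memNset /=; first by lra.
by rewrite in_itv /= => ?; lra.
Qed.

Lemma f_ge (R : realType) (y : R) : - (1 / 3) <= f y.
Proof. by rewrite /f indicE; case: (_ \in _) => /=; lra. Qed.

(** Modulo 1, exactly one of the three points lies in the middle third, so the values are [2 / 3]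
    once and [- (1 / 3)] twice. *)
Lemma f_thirds_sum (R : realType) (y : R) :
  f y + f (y + 1 / 3) + f (y + 2 / 3) = 0.
Proof.
have E c : f (y + c) = f (fracpart y + c).
  by rewrite -[RHS](fDint R _ (Num.floor y)) /fracpart addrAC subrK.
rewrite -[in f y](addr0 y) !E addr0; have := fracpart_itv R y.
move: (fracpart y) => t ht.
have wrap c : f (t + c) = f (t + c - 1) by rewrite -[in RHS]f_periodic subrK.
have [h1|h1] := ltP t (1 / 3).
  rewrite f_outer_thirds ?h1 // f_middle_third; last by lra.
  by rewrite f_outer_thirds; lra.
have [h2|h2] := ltP t (2 / 3).
  rewrite f_middle_third; last by lra.
  rewrite f_outer_thirds; [|lra|lra].
  by rewrite wrap f_outer_thirds; lra.
rewrite f_outer_thirds ?h2 ?orbT //.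
rewrite wrap f_outer_thirds; [|lra|lra].
by rewrite wrap f_middle_third; lra.
Qed.

(** The shifts [a / 3] and [2 * a / 3] are integers when 3 divides [a]; otherwise they are [1 / 3]
    and [2 / 3] modulo 1 in some order, and the three translates cancel. *)
Lemma f_dilate_thirds_sum (R : realType) (a : nat) (x : R) :
  f (a%:R * x) + f (a%:R * (x + 1 / 3)) + f (a%:R * (x + 2 / 3)) =
  if (3 %| a)%N then f (a%:R * x) *+ 3 else 0.
Proof.
have E (q r : nat) : (q * 3 + r)%:R = q%:R * 3 + r%:R :> R.
  by rewrite natrD natrM.
have := divn_eq a 3; have : (a %% 3 < 3)%N by rewrite ltn_mod.
rewrite /dvdn; move: (a %% 3)%N (a %/ 3)%N => [|[|[|//]]] q _ ->; rewrite E.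
- have -> : (q%:R * 3 + 0%:R) * (x + 1 / 3) = (q%:R * 3 + 0%:R) * x + q%:R by lra.
  have -> : (q%:R * 3 + 0%:R) * (x + 2 / 3) = (q%:R * 3 + 0%:R) * x + (2 * q)%:R.
    by rewrite natrM; lra.
  by rewrite !fDnat /= !mulrS mulr0n; ring.
- set y := _ * x.
  have -> : (q%:R * 3 + 1%:R) * (x + 1 / 3) = y + 1 / 3 + q%:R by rewrite /y; lra.
  have -> : (q%:R * 3 + 1%:R) * (x + 2 / 3) = y + 2 / 3 + (2 * q)%:R.
    by rewrite natrM /y; lra.
  by rewrite !fDnat f_thirds_sum.
- set y := _ * x.
  have -> : (q%:R * 3 + 2%:R) * (x + 1 / 3) = y + 2 / 3 + q%:R by rewrite /y; lra.
  have -> : (q%:R * 3 + 2%:R) * (x + 2 / 3) = y + 1 / 3 + (2 * q + 1)%:R.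
    by rewrite natrD natrM /y; lra.
  by rewrite !fDnat addrAC f_thirds_sum.
Qed.

Definition mult3 (A : {fset nat}) : {fset nat} := [fset a in A | (3 %| a)%N]%fset.

Definition third (A : {fset nat}) : {fset nat} :=
  [fset (a %/ 3)%N | a in mult3 A]%fset.

Lemma divn3_inj (A : {fset nat}) : {in mult3 A &, injective (fun a => a %/ 3)%N}.
Proof.
move=> a b; rewrite !inE /= => /andP[_ /divnK {2}<-] /andP[_ /divnK {2}<-].
by move=> ->.
Qed.

Lemma card_third (A : {fset nat}) : #|` third A| = count (fun a => 3 %| a)%N A.
Proof.
rewrite card_in_imfset; last exact: divn3_inj.
by rewrite -sum1_size -sum1_count big_fset.
Qed.

Lemma f_sum_third (R : realType) (A : {fset nat}) (x : R) :
  f_sum (third A) x = \sum_(a <- A | (3 %| a)%N) f (a%:R * (x / 3)).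
Proof.
rewrite /f_sum big_imfset /=; last exact: divn3_inj.
rewrite big_fset /=; apply: eq_bigr => a /divnK {2}<-.
by rewrite natrM; congr f; lra.
Qed.

Lemma m_max_third (R : realType) (A : {fset nat}) :
  m_max R (third A) <= m_max R A.
Proof.
(* At a maximum point [z] of [third A], the average of [f_sum A] over [z / 3] and its two translates
   equals the maximum for [third A]. *)
have [z <-] := m_max_attained R (third A); rewrite f_sum_third.
set x := z / 3.
have h : f_sum A x + f_sum A (x + 1 / 3) + f_sum A (x + 2 / 3) =
    (\sum_(a <- A | (3 %| a)%N) f (a%:R * x)) *+ 3.
  rewrite /f_sum -!big_split /= -sumrMnl [RHS]big_mkcond.
  by apply: eq_bigr => a _; rewrite f_dilate_thirds_sum.
have := m_max_ub A x; have := m_max_ub A (x + 1 / 3).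
have := m_max_ub A (x + 2 / 3); move: h; rewrite !mulrS mulr0n; lra.
Qed.

(** Elements satisfying [p] contribute [2 / 3 = 1 - 1 / 3] at [x], and all others at least
    [- (1 / 3)]. *)
Lemma count_le_m_max (R : realType) (A : {fset nat}) (p : pred nat) (x : R) :
  (forall a, a \in A -> p a -> f (a%:R * x) = 2 / 3) ->
  (count p A)%:R - #|` A|%:R / 3 <= m_max R A.
Proof.
move=> h; apply: le_trans (m_max_ub A x).
have -> : (count p A)%:R - #|` A|%:R / 3 = \sum_(a <- A) ((p a)%:R - 1 / 3) :> R.
  elim: (enum_fset A) => [|a s IH] /=; first by rewrite big_nil mul0r subr0.
  by rewrite big_cons -IH natrD -[(size s).+1]add1n natrD; lra.
rewrite /f_sum !big_seq; apply: ler_sum => a aA.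
case: (boolP (p a)) => [pa|_]; first by rewrite h //=; lra.
by have := f_ge R (a%:R * x); rewrite /=; lra.
Qed.

Lemma count_mod3_1_le_m_max (R : realType) (A : {fset nat}) :
  (count (fun a => a %% 3 == 1)%N A)%:R - #|` A|%:R / 3 <= m_max R A.
Proof.
apply: (count_le_m_max R A _ (1 / 3)) => a _ /eqP ha.
rewrite (divn_eq a 3) ha natrD natrM.
have -> : ((a %/ 3)%:R * 3%:R + 1%:R) * (1 / 3) = 1 / 3 + (a %/ 3)%:R :> R by lra.
by rewrite fDnat f_middle_third; lra.
Qed.

(** At [1 / 3] itself these elements land on the excluded endpoint [2 / 3] modulo 1; a small shift
    to the left brings them inside. *)
Lemma count_mod3_2_le_m_max (R : realType) (A : {fset nat}) :
  (count (fun a => a %% 3 == 2)%N A)%:R - #|` A|%:R / 3 <= m_max R A.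
Proof.
pose M := (\max_(a <- A) a)%N.
have MP : 0 < M.+1%:R :> R by rewrite ltr0n.
(* Small enough that [a%:R * e <= 1 / 3] for every [a] in [A], so the shifted point does not fall
   below [1 / 3]. *)
pose e : R := (M.+1%:R)^-1 / 3.
apply: (count_le_m_max R A _ (1 / 3 - e)) => a aA /eqP ha.
have aM : (a <= M)%N by exact: (leq_bigmax_seq a).
have ae : 0 < a%:R * e <= 1 / 3.
  have a0 : (0 < a)%N by case: a ha {aA aM}.
  have Me : M.+1%:R * e = 1 / 3 by rewrite /e mulrA divff ?gt_eqF.
  have e0 : 0 < e by rewrite /e divr_gt0 ?invr_gt0.
  rewrite mulr_gt0 ?ltr0n //= -Me ler_pM2r // ler_nat; lia.
have -> : a%:R * (1 / 3 - e) = (2 / 3 - a%:R * e) + (a %/ 3)%:R.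
  have : a%:R = (a %/ 3)%:R * 3 + 2 :> R.
    by rewrite {1}(divn_eq a 3) ha natrD natrM.
  by lra.
by rewrite fDnat f_middle_third; lra.
Qed.

Lemma count_mod3 (s : seq nat) :
  (size s = count (fun a => 3 %| a) s + count (fun a => a %% 3 == 1) s +
            count (fun a => a %% 3 == 2) s)%N.
Proof.
elim: s => //= a s ->; rewrite /dvdn.
have : (a %% 3 < 3)%N by rewrite ltn_mod.
by case: (a %% 3)%N => [|[|[|//]]] /= _; lia.
Qed.

Theorem theorem2 (R : realType) (S N_S : nat) (hS : (0 < S)%N)
  (hyp : forall n : nat, (N_S < n <= 3 * N_S + 2 * S)%N ->
     forall A : {fset nat}, (forall a : nat, a \in A -> (0 < a)%N) ->
       #|` A|%fset = n -> S%:R / 3 <= m_max R A) :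
  forall n : nat, (N_S < n)%N ->
    forall A : {fset nat}, (forall a : nat, a \in A -> (0 < a)%N) ->
      #|` A|%fset = n -> S%:R / 3 <= m_max R A.
Proof.
(* Induction on a bound [M] for the elements: dividing a positive multiple of 3 by 3 gives a
   strictly smaller positive integer. *)
suff main M (A : {fset nat}) : (forall a, a \in A -> 0 < a <= M)%N ->
    (N_S < #|` A|)%N -> S%:R / 3 <= m_max R A.
  move=> n Nn A A0 An; apply: (main (\max_(a <- A) a)%N); last by rewrite An.
  by move=> a aA; rewrite A0 //=; exact: (leq_bigmax_seq a).
elim: M A => [|M IH] A AM NA.
  have A_empty : A = fset0.
    by apply/fsetP => a; rewrite inE; apply/negP => /AM; case: a.
  by rewrite A_empty cardfs0 in NA.
have [small|large] := leqP #|` A| (3 * N_S + 2 * S).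
  by apply: (hyp #|` A|) => //; [rewrite NA | move=> a /AM /andP[]].
have [few|many] := leqP #|` third A| N_S; last first.
  apply: le_trans (m_max_third R A); apply: IH many => b.
  move=> /imfsetP[a /=]; rewrite !inE /= => /andP[/AM aM d3] ->.
  by move: aM d3; lia.
(* At least [#|A| - N_S] elements are prime to 3, so adding the two bounds gives
   [2 * m_A >= #|A| / 3 - N_S >= 2 * S / 3]. *)
have := count_mod3_1_le_m_max R A; have := count_mod3_2_le_m_max R A.
have /(congr1 (fun k => k%:R : R)) := count_mod3 A; rewrite -card_third !natrD.
have : #|` third A|%:R <= N_S%:R :> R by rewrite ler_nat.
have : (3 * N_S + 2 * S)%:R <= #|` A|%:R :> R by rewrite ler_nat ltnW.
rewrite natrD !natrM; lra.
Qed.
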